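(* For bivariate copulas $D,E$, the following are equivalent: (i) $D\le_{\partial_2S}E$; (ii) $\mathcal{T}(D)\ge_{lo}\mathcal{T}(E)$; (iii) $\mathcal{T}(D)\ge_{\partial_2S}\mathcal{T}(E)$; (iv) $\mathcal{T}^2(D)\le_{lo}\mathcal{T}^2(E)$; (v) $\mathcal{T}^2(D)\le_{\partial_2S}\mathcal{T}^2(E)$.
   Context: $\Pi(u,v)=uv$; $\partial_2$ the partial derivative in the second argument; $D\vee E(u,v):=\int_0^1\min\{\partial_2D(u,t),\partial_2E(v,t)\}\,dt$; $\mathcal{T}(C):=C\vee\Pi$, $\mathcal{T}^2=\mathcal{T}\circ\mathcal{T}$. $D\le_{lo}E$ means $D(u,v)\le E(u,v)$ for all $(u,v)\in[0,1]^2$. For measurable $f:(0,1)\to[0,1]$, $f^*$ is the a.e.-unique decreasing function with $\lambda(f^*\le y)=\lambda(f\le y)$ for all $y$; $f\prec_S g$ means $\int_0^vf^*(t)\,dt\le\int_0^vg^*(t)\,dt$ for all $v\in(0,1)$ with equality for $v=1$. $D\le_{\partial_2S}E$ means $\partial_2D(v,\cdot)\prec_S\partial_2E(v,\cdot)$ for all $v\in(0,1)$. *)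

(* Defs.v *)
From HB Require Import structures.
From mathcomp Require Import all_boot all_order all_algebra.
From mathcomp Require Import all_classical all_reals all_analysis.
Set Implicit Arguments. Unset Strict Implicit. Unset Printing Implicit Defensive.
Import Order.TTheory GRing.Theory Num.Theory.
Import numFieldNormedType.Exports.
Local Open Scope classical_set_scope.
Local Open Scope ring_scope.

Section Copulas.
Variable R : realType.

Definition is_copula (C : R -> R -> R) : Prop :=
  (forall u, 0 <= u <= 1 -> C u 0 = 0 /\ C 0 u = 0 /\ C u 1 = u /\ C 1 u = u) /\
  (forall u1 u2 v1 v2, 0 <= u1 -> u1 <= u2 -> u2 <= 1 ->
       0 <= v1 -> v1 <= v2 -> v2 <= 1 ->
       0 <= C u2 v2 - C u2 v1 - C u1 v2 + C u1 v1).

Definition Pi (u v : R) : R := u * v.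

(* partial derivative in the second argument (total: MathComp's derive1,
   meaningful a.e., which is all that is used below) *)
Definition d2 (C : R -> R -> R) (u t : R) : R := derive1 (fun s => C u s) t.

Definition cjoin (D E : R -> R -> R) (u v : R) : R :=
  Rintegral lebesgue_measure `[0, 1]%classic
    (fun t => Num.min (d2 D u t) (d2 E v t)).

Definition T (C : R -> R -> R) : R -> R -> R := cjoin C Pi.
Definition T2 (C : R -> R -> R) : R -> R -> R := T (T C).

Definition le_lo (D E : R -> R -> R) : Prop :=
  forall u v, 0 <= u <= 1 -> 0 <= v <= 1 -> D u v <= E u v.

(* g is a (the a.e.-unique) decreasing rearrangement of f on (0,1) *)
Definition is_decr_rearr (f g : R -> R) : Prop :=
  (forall s t, 0 < s -> s <= t -> t < 1 -> g t <= g s) /\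
  (forall y : R, lebesgue_measure (`]0, 1[%classic `&` [set t | g t <= y]) =
                 lebesgue_measure (`]0, 1[%classic `&` [set t | f t <= y])).

Definition schur_le (f g : R -> R) : Prop :=
  forall fs gs, is_decr_rearr f fs -> is_decr_rearr g gs ->
    (forall v, 0 < v < 1 ->
       Rintegral lebesgue_measure `[0, v]%classic fs <=
       Rintegral lebesgue_measure `[0, v]%classic gs) /\
    Rintegral lebesgue_measure `[0, 1]%classic fs =
    Rintegral lebesgue_measure `[0, 1]%classic gs.

Definition le_d2S (D E : R -> R -> R) : Prop :=
  forall v, 0 < v < 1 -> schur_le (d2 D v) (d2 E v).

End Copulas.

(* Main.v *)
Require Import Defs.
From HB Require Import structures.
From mathcomp Require Import all_boot all_order all_algebra.
From mathcomp Require Import all_classical all_reals all_analysis.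
From mathcomp Require Import measurable_realfun ring lra.

(** Fix u and write f for the derivative of C(u, .), f^* for its decreasing
    rearrangement and H(c) for the integral over [0, 1] of min(f, c), so that
    T(C)(u, c) = H(c). Up to the constant mean of f, H is a concave conjugate of
    v |-> int_0^v f^*: one has int_0^v f^* + H(c) <= c v + int_0^1 f, with
    equality for some c given v and for some v given c. Hence larger rearranged
    integrals correspond to smaller H, which is (i) <-> (ii). Moreover the slices
    of T(C) are monotone, 1-Lipschitz and concave, so their derivatives are
    already decreasing and on T-images the Schur order in the second argument is
    the pointwise order; this gives (ii) <-> (iii) and (iv) <-> (v), while
    (iii) <-> (iv) is (i) <-> (ii) applied to T(E) and T(D). *)

Set Implicit Arguments. Unset Strict Implicit. Unset Printing Implicit Defensive.
Import Order.TTheory GRing.Theory Num.Theory.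
Import numFieldNormedType.Exports.
Local Open Scope classical_set_scope.
Local Open Scope ring_scope.

(** * Integrals and outer measure off a null set *)

Section NullSets.
Context (R : realType).
Notation mu := (@lebesgue_measure R).
Local Open Scope ereal_scope.
Import HBNNSimple.

(** Monotonicity and subadditivity of the outer measure suffice, so the sets may be arbitrary. This
    matters for sublevel sets of [d2], which are not known to be Borel. *)
Lemma le_lebesgue_off_null (N A B : set R) :
  mu N = 0 -> A `\` N `<=` B -> mu A <= mu B.
Proof.
move=> N0 AB.
have AN : A `<=` B `|` N.
  move=> x Ax; case: (pselect (N x)) => [|nN]; first by right.
  by left; exact: AB.
apply: (@le_trans _ _ (mu (B `|` N))).
  exact: (@le_outer_measure _ _ (mu_ext (@wlength R idfun))).
rewrite -[leRHS]adde0 -N0.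
exact: (@outer_measureU2 _ _ (mu_ext (@wlength R idfun))).
Qed.

(** The integral of a nonnegative function is a supremum over simple functions below it. A simple
    function below [f], once set to 0 on [N], lies below [g] and keeps its integral. *)
Lemma ge0_integral_off_null_le (N D : set R) (f g : R -> \bar R) :
  measurable N -> mu N = 0 -> (forall x, D x -> 0 <= f x) ->
  (forall x, D x -> 0 <= g x) -> (forall x, D x -> ~ N x -> f x = g x) ->
  \int[mu]_(x in D) f x <= \int[mu]_(x in D) g x.
Proof.
move=> mN N0 f0 g0 fg.
rewrite !ge0_integralE//; apply: ge_ereal_sup => _ [h /= hf <-].
have mNC : measurable (~` N) by exact: measurableC.
pose h' := proj_nnsfun h mNC.
have <- : sintegral mu h' = sintegral mu h.
  rewrite -!integralT_nnsfun.
  apply: ae_eq_integral => //.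
  - exact/measurable_EFinP.
  - exact/measurable_EFinP.
  - exists N; split => // x /=; apply: contra_notP => nN _.
    by rewrite /h' /= mindicE mem_set ?mulr1.
apply: ereal_sup_ubound; exists h' => //= x.
rewrite mindicE.
have [|] := boolP (x \in ~` N); rewrite ?inE/= => xN.
  rewrite mulr1; apply: (le_trans (hf x)).
  rewrite !patchE; case: ifPn => //; rewrite inE => Dx.
  by rewrite fg.
rewrite mulr0 patchE; case: ifPn => //; rewrite inE => Dx; exact: g0.
Qed.

(* Neither function is assumed measurable: [d2 C u] takes junk values on a
   null set that is not known to be Borel. *)
Lemma integral_off_null (N D : set R) (f g : R -> \bar R) :
  measurable N -> mu N = 0 -> (forall x, D x -> ~ N x -> f x = g x) ->
  \int[mu]_(x in D) f x = \int[mu]_(x in D) g x.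
Proof.
move=> mN N0 fg.
rewrite [LHS]integralE [RHS]integralE.
congr (_ - _); apply/eqP; rewrite eq_le; apply/andP; split;
  apply: (ge0_integral_off_null_le mN N0) => // x Dx nN.
- by rewrite ?funeposE ?funenegE (fg _ Dx nN).
- by rewrite ?funeposE ?funenegE (fg _ Dx nN).
- by rewrite ?funeposE ?funenegE (fg _ Dx nN).
- by rewrite ?funeposE ?funenegE (fg _ Dx nN).
Qed.

Lemma Rintegral_off_null (N D : set R) (f g : R -> R) :
  measurable N -> mu N = 0 -> (forall x, D x -> ~ N x -> f x = g x) ->
  Rintegral mu D f = Rintegral mu D g.
Proof.
move=> mN N0 fg; congr fine.
by apply: (integral_off_null mN N0) => x Dx nN; rewrite fg.
Qed.

End NullSets.

(** * Monotone 1-Lipschitz functions and their derivatives *)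

Section Density.
Context (R : realType).
Notation mu := (@lebesgue_measure R).

(** Nondecreasing and 1-Lipschitz on [D], as a single two-sided bound that [lra] can use. *)
Definition slope01 (D : set R) (F : R -> R) :=
  forall s t, D s -> D t -> s <= t -> 0 <= F t - F s <= t - s.

Lemma slope01_nondecreasing F : slope01 setT F -> nondecreasing F.
Proof. by move=> FL s t st; have := FL s t I I st; lra. Qed.

Lemma slope01_continuous F : slope01 setT F -> continuous F.
Proof.
move=> FL x; apply/cvgrPdist_le => e e0; near=> y.
have xy : `|x - y| <= e by near: y; apply: cvgr_dist_le.
apply: le_trans xy.
have [st|/ltW st] := leP x y.
- have := FL x y I I st; move=> ?.
  rewrite ler0_norm; last lra.
  rewrite ler0_norm; lra.
- have := FL y x I I st; move=> ?.
  rewrite ger0_norm; last lra.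
  rewrite ger0_norm; lra.
Unshelve. all: by end_near. Qed.

Lemma slope01_compl F : slope01 setT F -> slope01 setT (fun x => x - F x).
Proof. by move=> FL s t _ _ st; have := FL s t I I st; lra. Qed.

Definition stieltjes_of F (FL : slope01 setT F) : cumulative R R :=
  HB.pack F (@isCumulative.Build R _ R F (slope01_nondecreasing FL)
    (right_continuousW (slope01_continuous FL))).

Lemma lebesgue_stieltjes_measure_itvoc (F : cumulative R R) (a b : R) : a <= b ->
  lebesgue_stieltjes_measure F `]a, b] = (F b - F a)%:E.
Proof.
move=> ab.
rewrite /lebesgue_stieltjes_measure /measure_extension/=.
rewrite measurable_mu_extE/=; last exact: is_ocitv.
by rewrite wlength_itv_bnd.
Qed.

Lemma stieltjes_ofE F (FL : slope01 setT F) (a b : R) : a <= b ->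
  lebesgue_stieltjes_measure (stieltjes_of FL) `]a, b] = (F b - F a)%:E.
Proof. exact: lebesgue_stieltjes_measure_itvoc. Qed.

(* The Stieltjes measures of [F] and [id - F] add up to Lebesgue measure. *)
Lemma stieltjes_of_dominates F (FL : slope01 setT F) :
  lebesgue_stieltjes_measure (stieltjes_of FL) `<< mu.
Proof.
apply/null_content_dominatesP => A mA muA.
have GL := slope01_compl FL.
pose nu := lebesgue_stieltjes_measure (stieltjes_of FL).
pose nu' := lebesgue_stieltjes_measure (stieltjes_of GL).
have E : mu A = measure_add nu nu' A.
  (* Lebesgue measure is determined by half-open intervals, and there the increments of [F] and
     [id - F] add up to [b - a]. *)
  apply: lebesgue_measure_unique => // X [[a b] _ <-]; rewrite [RHS]measure_addE /=.
  have [ba|/ltW ab] := leP b a.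
    by rewrite set_itv_ge ?measure0 ?adde0// bnd_simp -leNgt.
  rewrite [X in (_ = X + _)%E]stieltjes_ofE// [X in (_ = _ + X)%E]stieltjes_ofE//.
  rewrite -EFinD.
  have -> : mu `]a, b] = (b - a)%:E.
    rewrite lebesgue_measure_itv /= lte_fin; case: ifPn => // h.
    by rewrite (_ : a = b) ?subrr//; lra.
  congr (_%:E); lra.
apply/eqP; rewrite eq_le measure_ge0 andbT.
have <- : measure_add nu nu' A = 0%E by rewrite -E.
by rewrite measure_addE leeDl.
Qed.

(** Radon-Nikodym for the Stieltjes measure of [F], restricted to []0, 1]] to make it finite. *)
Lemma slope01_density_global F : slope01 setT F -> exists2 g : R -> R,
  mu.-integrable setT (EFin \o g) &
  forall v, 0 <= v <= 1 -> Rintegral mu `]0, v] g = F v - F 0.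
Proof.
move=> FL; pose nu0 := lebesgue_stieltjes_measure (stieltjes_of FL).
have mI : measurable (`]0, 1]%classic : set (measurableTypeR R)) by [].
have nuI : (nu0 `]0%R, 1%R]%classic < +oo)%E by rewrite /nu0 stieltjes_ofE// ltry.
pose nu : {finite_measure set (measurableTypeR R) -> \bar R} := mfrestr mI nuI.
have numu : nu `<< mu.
  apply/null_content_dominatesP => A mA muA.
  rewrite /nu/= /mfrestr/= /mrestr.
  have /null_content_dominatesP := stieltjes_of_dominates FL; apply => //.
    exact: measurableI.
  apply/eqP; rewrite eq_le measure_ge0 andbT -muA; apply: le_measure => //.
  - by rewrite inE; exact: measurableI.
  - by rewrite inE.
pose g := Radon_Nikodym_SigmaFinite.f nu mu.
have gfin := Radon_Nikodym_SigmaFinite.f_fin_num numu.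
exists (fine \o g).
  rewrite (_ : EFin \o _ = g); first exact: Radon_Nikodym_SigmaFinite.f_integrable.
  by apply/funext => x/=; rewrite fineK.
move=> v v01; rewrite /Rintegral.
rewrite (_ : (\int[mu]_(x in _) _)%E = nu `]0, v]%classic); last first.
  rewrite (Radon_Nikodym_SigmaFinite.f_integral numu)//.
  by apply: eq_integral => x _; rewrite fineK.
rewrite /nu/= /mfrestr/= /mrestr setIidl.
  by rewrite stieltjes_ofE//; lra.
by apply: subset_itvl; rewrite bnd_simp; lra.
Qed.

(** Serves twice: precomposed, it extends a function from the unit interval to the line;
    postcomposed, it forces a density into the unit interval. *)
Definition clamp (x : R) := Num.max 0 (Num.min 1 x).

Lemma clampE x : clamp x = if x <= 0 then 0 else if 1 <= x then 1 else x.
Proof.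
by rewrite /clamp maxEle minEle; do ![case: ifPn => //]; rewrite -?ltNge; lra.
Qed.

Lemma clamp01 x : 0 <= clamp x <= 1.
Proof. by rewrite clampE; do ![case: ifPn]; rewrite -?ltNge; lra. Qed.

Lemma clamp_id x : 0 <= x <= 1 -> clamp x = x.
Proof. by rewrite clampE; do ![case: ifPn]; rewrite -?ltNge; lra. Qed.

Lemma clamp_slope s t : s <= t -> 0 <= clamp t - clamp s <= t - s.
Proof. by rewrite !clampE; do ![case: ifPn]; rewrite -?ltNge; lra. Qed.

Lemma measurable_clamp (f : R -> R) : measurable_fun setT f ->
  measurable_fun setT (clamp \o f).
Proof.
move=> mf; apply: measurable_maxr => //; exact: measurable_minr.
Qed.

Lemma null_setU_endpoints (N : set R) (a b : R) :
  measurable N -> mu N = 0%E -> mu (N `|` [set a; b]) = 0%E.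
Proof.
move=> mN N0.
have mab : measurable ([set a; b] : set (measurableTypeR R)).
  by apply: measurableU; exact: measurable_set1.
apply: measure_negligible; first exact: measurableU.
apply: negligibleU; apply/negligibleP => //.
by apply: countable_lebesgue_measure0; apply: finite_set_countable.
Qed.

(** For small [h] of either sign the difference quotient at [x] is at least [c], and the bound
    passes to the limit. *)
Lemma derive1_ge (F : R -> R) (x a b c : R) : a < x < b ->
  (forall s t, a < s -> s <= t -> t < b -> c * (t - s) <= F t - F s) ->
  derivable F x 1 -> c <= derive1 F x.
Proof.
move=> /andP[ax xb] Fc dF; rewrite derive1E; apply: limr_ge => //; near=> h.
have h0 : h != 0 by near: h; exact: nbhs_dnbhs_neq.
have hd : `|h| < Num.min (x - a) (b - x).
  near: h; apply: dnbhs0_lt; rewrite lt_min; lra.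
have {hd} : a < x + h < b.
  by move: hd; rewrite lt_min => /andP[]; rewrite !ltr_norml; lra.
rewrite /= [h *: 1]mulr1 [_ *: _]/(_ * _) (addrC h x) => xhb.
have [hn|hp|/eqP] := ltgtP h 0; last by rewrite (negbTE h0).
- rewrite ler_ndivlMl//.
  have := Fc (x + h) x; rewrite (_ : c * (x - (x + h)) = - (h * c)); [lra|ring].
- rewrite ler_pdivlMl//.
  have := Fc x (x + h); rewrite (_ : c * (x + h - x) = h * c); [lra|ring].
Unshelve. all: by end_near. Qed.

Lemma derive1_le (F : R -> R) (x a b c : R) : a < x < b ->
  (forall s t, a < s -> s <= t -> t < b -> F t - F s <= c * (t - s)) ->
  derivable F x 1 -> derive1 F x <= c.
Proof.
move=> axb Fc dF; rewrite -lerN2 !derive1E -deriveN//.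
have := @derive1_ge (fun x => - F x) x a b (- c) axb.
rewrite !derive1E; apply => [s t xs st tb|]; last exact: derivableN.
have := Fc s t xs st tb; rewrite mulNr; lra.
Qed.

(* [f] is a Borel version of the derivative of [F]: a Radon-Nikodym density of
   the Stieltjes measure, identified a.e. by Lebesgue differentiation. *)
Lemma slope01_density (F : R -> R) : slope01 `[0, 1] F ->
  exists (f : R -> R) (N : set R), [/\ [/\ measurable_fun setT f & forall x, 0 <= f x <= 1],
    measurable N /\ mu N = 0,
    forall t, 0 < t < 1 -> ~ N t -> derivable F t 1 /\ derive1 F t = f t &
    forall v, 0 <= v <= 1 -> Rintegral mu `[0, v] f = F v - F 0].
Proof.
move=> FL; pose G := F \o clamp.
have GL : slope01 setT G.
  move=> s t _ _ st; have := clamp_slope st; have := clamp01 s; have := clamp01 t.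
  move=> t01 s01 cst; have := FL (clamp s) (clamp t).
  rewrite /= !in_itv/= => /(_ s01 t01); rewrite /G/=; lra.
have GF v : 0 <= v <= 1 -> G v = F v by move=> v01; rewrite /G/= clamp_id.
have [g gint gE] := slope01_density_global GL.
have gS A : measurable A -> mu.-integrable A (EFin \o g).
  by move=> mA; exact: integrableS gint.
have lg : locally_integrable setT g.
  by apply: open_integrable_locally => //; exact: openT.
(* Lebesgue differentiation: outside [N], the integral function [J] below has derivative [g]. *)
have [N [mN N0 NP]] := FTC1 (a := BRight 0) (fun y => gS _ (measurable_itv _)) lg.
pose J (x : R) := Rintegral mu `]0, x]%classic g.
have P t : 0 < t < 1 -> ~ N t -> derivable F t 1 /\ derive1 F t = g t.
  move=> t01 Nt.
  have [d1 d2] : derivable J t 1 /\ derive1 J t = g t.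
    apply: contrapT => H; apply: Nt; apply: NP => /= K; apply: H; apply: K.
    by case/andP: t01.
  (* The two functions are known to agree only on the unit interval, but agreement near [t] is
     enough to transfer the derivative. *)
  have nF : \near t, J t = F t - F 0.
    near=> s.
    have s01 : 0 < s < 1.
      apply/andP; split; near: s; [apply: lt_nbhsr|apply: lt_nbhsl]; lra.
    by rewrite /J gE ?GF; lra.
  have nF' : \near t, F t = J t + F 0.
    by apply: filterS nF => s ->; rewrite subrK.
  split.
    apply: (@near_eq_derivable _ _ _ (fun x => J x + F 0)).
      by apply: filterS nF' => s ->.
    by apply: derivableD => //; exact: derivable_cst.
  rewrite derive1E (near_eq_derive _ nF') deriveD//.
  by rewrite derive_cst addr0 -derive1E.
exists (clamp \o g), N.
have mg : measurable_fun setT g by case: lg.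
(* Off [N], [g] is the derivative of [F], which the slope bounds keep in the unit interval; clamping
   changes nothing there. *)
have cg t : 0 < t < 1 -> ~ N t -> g t = clamp (g t).
  move=> t01 Nt; have [d1 <-] := P t t01 Nt.
  rewrite clamp_id//; apply/andP; split.
    apply: (derive1_ge t01) => // s r s0 sr r1; have := FL s r.
    rewrite /= !in_itv/=; lra.
  apply: (derive1_le t01) => // s r s0 sr r1; have := FL s r.
  rewrite /= !in_itv/=; lra.
split.
- by split=> [|x]; [exact: measurable_clamp|exact: clamp01].
- by [].
- by move=> t t01 Nt; have [? ->] := P t t01 Nt; rewrite {1}cg.
- move=> v v01; rewrite -!GF -?gE//; [|lra..].
  rewrite Rintegral_itv_obnd_cbnd; last exact: gS.
  apply: (@Rintegral_off_null _ (N `|` [set 0; 1])) => //.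
  + by apply: measurableU => //; apply: measurableU.
  + by apply: null_setU_endpoints.
  + move=> x; rewrite /= in_itv/= => xv /not_orP[Nx /not_orP[x0 x1]].
    rewrite -cg//; move/eqP: x0; move/eqP: x1; rewrite !neq_lt; lra.
Unshelve. all: by end_near. Qed.

End Density.

(** * Decreasing rearrangements *)

Section Rearrangement.
Context (R : realType).
Notation mu := (@lebesgue_measure R).
Implicit Types (f g fs : R -> R) (c v : R).

Definition unit_fun f := measurable_fun setT f /\ forall x, 0 <= f x <= 1.

Definition equidistributed f g := forall y : R,
  mu (`]0, 1[ `&` [set t | g t <= y]) = mu (`]0, 1[ `&` [set t | f t <= y]).

Definition trunc_int f c := Rintegral mu `[0, 1] (fun t => Num.min (f t) c).

(** * Distribution functions under the uniform law on the unit interval *)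

Lemma le_lebesgue_outer (A B : set R) : A `<=` B -> (mu A <= mu B)%E.
Proof.
move=> AB; apply: (@le_lebesgue_off_null R set0); first exact: measure0.
by move=> x [/AB].
Qed.

Lemma lebesgue_oo (a b : R) : a <= b -> mu `]a, b[ = (b - a)%:E.
Proof.
move=> ab; rewrite lebesgue_measure_itv/= lte_fin; case: ifPn => // h.
by rewrite (_ : a = b) ?subrr//; lra.
Qed.

Let P := uniform_prob (@ltr01 R).

Lemma uniform01E (A : set R) : measurable A -> P A = mu (`]0, 1[ `&` A).
Proof.
move=> mA.
transitivity (\int[P]_x (\1_A x)%:E)%E; first by rewrite integral_indic ?setIT.
rewrite integral_uniform//; last exact/measurable_EFinP.
rewrite subr0 invr1 mul1e -integral_itv_bndo_bndc//; last first.
  exact/measurable_EFinP/measurable_funTS.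
rewrite -integral_itv_obnd_cbnd//; last first.
  exact/measurable_EFinP/measurable_funTS.
by rewrite integral_indic// setIC.
Qed.

Definition mfun_of f (mf : measurable_fun setT f) :
    {RV P >-> R} :=
  HB.pack f (@isMeasurableFun.Build _ _ (measurableTypeR R) R f mf).

Lemma lebesgue_gtE f y : measurable_fun setT f ->
  mu (`]0, 1[ `&` [set t | y < f t]) =
  (1 - mu (`]0%R, 1%R[ `&` [set t | (f t <= y)%R]))%E.
Proof.
move=> mf.
have mle : measurable [set t | f t <= y].
  have -> : [set t | f t <= y] = f @^-1` `]-oo, y].
    by apply/seteqP; split => x /=; rewrite in_itv.
  by rewrite -[X in measurable X]setTI; exact: mf.
rewrite -!uniform01E//; last first.
  have -> : [set t | y < f t] = f @^-1` `]y, +oo[.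
    by apply/seteqP; split => x /=; rewrite in_itv/= andbT.
  by rewrite -[X in measurable X]setTI; exact: mf.
rewrite -probability_setC//; congr (P _).
by apply/seteqP; split => x /=; rewrite ltNge => /negP.
Qed.

(** Layer-cake formula: the integral of a nonnegative function is the integral of its tail
    probabilities, which equidistribution preserves. *)
Lemma equidistributed_integral f g : measurable_fun setT f ->
  measurable_fun setT g -> (forall x, 0 <= f x) -> (forall x, 0 <= g x) ->
  equidistributed f g -> Rintegral mu `[0, 1] f = Rintegral mu `[0, 1] g.
Proof.
move=> mf mg f0 g0 fg; congr fine.
have E (h : R -> R) (mh : measurable_fun setT h) (h0 : forall x, 0 <= h x) :
    (\int[mu]_(x in `[0%R, 1%R]) (h x)%:E =
     \int[mu]_(r in `[0%R, +oo[) (1 - mu (`]0%R, 1%R[ `&` [set t | (h t <= r)%R])))%E.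
  transitivity ('E_P[mfun_of mh])%E.
    rewrite expectation_def integral_uniform//.
      by rewrite subr0 invr1 mul1e.
    exact/measurable_EFinP.
  rewrite ge0_expectation_ccdf//; apply: eq_integral => r _.
  rewrite -lebesgue_gtE//; transitivity (P (h @^-1` `]r, +oo[%classic)) => //; rewrite uniform01E//.
    congr (mu (_ `&` _)).
    by apply/seteqP; split => x /=; rewrite in_itv/= andbT.
  by rewrite -[X in measurable X]setTI; exact: mh.
by rewrite (E _ mf f0) (E _ mg g0); apply: eq_integral => r _; rewrite fg.
Qed.

(** * Truncated integrals *)

Lemma unit_fun_min f c : unit_fun f -> 0 <= c ->
  unit_fun (fun t => Num.min (f t) c).
Proof.
move=> [mf f01] c0; split; first exact: measurable_minr.
by move=> x; have := f01 x; rewrite minEle; case: ifPn; rewrite -?ltNge; lra.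
Qed.

(** Truncation preserves equidistribution: at level [y] the sublevel set is everything if [c <= y],
    and that of the untruncated function otherwise. *)
Lemma equidistributed_trunc f g c : unit_fun f -> unit_fun g -> 0 <= c ->
  equidistributed f g -> trunc_int f c = trunc_int g c.
Proof.
move=> uf ug c0 fg; apply: equidistributed_integral.
- by case: (unit_fun_min uf c0).
- by case: (unit_fun_min ug c0).
- by move=> x; case: (unit_fun_min uf c0) => _ /(_ x)/andP[].
- by move=> x; case: (unit_fun_min ug c0) => _ /(_ x)/andP[].
- move=> y; have [cy|yc] := leP c y.
    congr (mu (_ `&` _)); apply/seteqP; split => x _ /=;
    by rewrite ge_min cy orbT.
  rewrite (_ : [set t | Num.min (g t) c <= y] = [set t | g t <= y]); last first.
    by apply/seteqP; split => x /=; rewrite ge_min (leNgt c) yc orbF.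
  rewrite (_ : [set t | Num.min (f t) c <= y] = [set t | f t <= y]) ?fg//.
  by apply/seteqP; split => x /=; rewrite ge_min (leNgt c) yc orbF.
Qed.

Lemma unit_fun_integrable f (a b : itv_bound R) : unit_fun f ->
  (BLeft 0 <= a)%O -> (b <= BRight 1)%O -> mu.-integrable [set` Interval a b] (EFin \o f).
Proof.
move=> [mf f01] a0 b1.
have f_int : mu.-integrable `[0, 1]%classic (EFin \o f).
  apply: measurable_bounded_integrable => //.
  - by rewrite /= lebesgue_measure_itv/= lte01 -EFinB ltry.
  - exact: measurable_funTS.
  - exists 1; split => // x x1 y _; have := f01 y => /andP[? ?].
    by rewrite /= ger0_norm//; lra.
by apply: integrableS f_int => //; exact: subset_itv.
Qed.

Lemma unit_fun_int01 f v : unit_fun f -> 0 <= v <= 1 ->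
  Rintegral mu `[0, 1] f =
  Rintegral mu `[0, v] f + Rintegral mu `]v, 1] f.
Proof.
move=> uf v01.
have f_int : mu.-integrable `[0, 1]%classic (EFin \o f).
  exact: unit_fun_integrable.
have v0 : (BLeft 0 <= BRight v)%O by rewrite bnd_simp; lra.
have v1 : (BRight v <= BRight 1)%O by rewrite bnd_simp; lra.
by rewrite -(Rintegral_itvB f_int v0 v1) addrC subrK.
Qed.

Lemma Rintegral_cst0v c v : 0 <= v -> Rintegral mu `[0, v] (fun=> c) = c * v.
Proof.
move=> v0; rewrite Rintegral_cst//= lebesgue_measure_itv/= lte_fin.
case: ifPn => [_|]; first by rewrite sube0.
by rewrite -leNgt => ?; rewrite (_ : v = 0) ?mulr0//; lra.
Qed.

(** Bound the minimum by [c] on [[0, v]] and by [f] on []v, 1]]. *)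
Lemma trunc_int_le f c v : unit_fun f -> 0 <= c -> 0 <= v <= 1 ->
  Rintegral mu `[0, v] f + trunc_int f c <= c * v + Rintegral mu `[0, 1] f.
Proof.
move=> uf c0 v01; have um := unit_fun_min uf c0.
rewrite /trunc_int (unit_fun_int01 um v01) (unit_fun_int01 uf v01).
have H1 : Rintegral mu `[0, v] (fun t => Num.min (f t) c) <= c * v.
  rewrite -Rintegral_cst0v; last lra.
  apply: le_Rintegral => //.
  - by apply: unit_fun_integrable; rewrite ?bnd_simp//; lra.
  - apply: measurable_bounded_integrable => //.
    + by rewrite /= lebesgue_measure_itv/=; case: ifPn => // _; rewrite -EFinB ltry.
    + exact: bounded_cst.
  - by move=> x _; rewrite ge_min lexx orbT.
have H2 : Rintegral mu `]v, 1] (fun t => Num.min (f t) c) <=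
    Rintegral mu `]v, 1] f.
  apply: le_Rintegral => //.
  - by apply: unit_fun_integrable; rewrite ?bnd_simp//; lra.
  - by apply: unit_fun_integrable; rewrite ?bnd_simp//; lra.
  - by move=> x _; rewrite ge_min lexx.
by rewrite addrCA; apply: lerD => //; rewrite lerD2l.
Qed.

(** Equality case of [trunc_int_le]: both bounds on the minimum are exact a.e. when [f] crosses the
    level [c] downwards at [v]. *)
Lemma trunc_int_eq f c v (N : set R) : unit_fun f -> 0 <= c -> 0 <= v <= 1 ->
  measurable N -> mu N = 0%E ->
  (forall t, 0 < t < v -> ~ N t -> c <= f t) ->
  (forall t, v < t < 1 -> ~ N t -> f t <= c) ->
  Rintegral mu `[0, v] f + trunc_int f c = c * v + Rintegral mu `[0, 1] f.
Proof.
move=> uf c0 v01 mN N0 fl fr; have um := unit_fun_min uf c0.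
rewrite /trunc_int (unit_fun_int01 um v01) (unit_fun_int01 uf v01).
have mN' : measurable (N `|` [set 0; v] `|` [set v; 1]).
  by do 2?[apply: measurableU => //]; apply: measurableU; exact: measurable_set1.
have N'0 : mu (N `|` [set 0; v] `|` [set v; 1]) = 0%E.
  apply: null_setU_endpoints; last exact: null_setU_endpoints.
  by do 2?[apply: measurableU => //]; exact: measurable_set1.
have H1 : Rintegral mu `[0, v] (fun t => Num.min (f t) c) = c * v.
  rewrite -Rintegral_cst0v; last lra.
  apply: (Rintegral_off_null mN' N'0) => x.
  rewrite /= in_itv/= => xv /not_orP[/not_orP[Nx /not_orP[/eqP x0 /eqP xv']] _].
  apply/min_idPr; apply: fl => //; move: x0 xv'; rewrite !neq_lt; lra.
have H2 : Rintegral mu `]v, 1] (fun t => Num.min (f t) c) =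
    Rintegral mu `]v, 1] f.
  apply: (Rintegral_off_null mN' N'0) => x.
  rewrite /= in_itv/= => xv /not_orP[/not_orP[Nx _] /not_orP[/eqP x0 /eqP xv']].
  apply/min_idPl; apply: fr => //; move: x0 xv'; rewrite !neq_lt; lra.
by rewrite addrCA H1 H2.
Qed.

(** * Conjugacy of cumulative and truncated integrals *)

Definition cum_int f v := Rintegral mu `[0, v] f.

Lemma equidistributed_off_null f0 f (N : set R) : mu N = 0%E ->
  (forall t, 0 < t < 1 -> ~ N t -> f0 t = f t) -> equidistributed f0 f.
Proof.
move=> N0 ff y; apply/eqP; rewrite eq_le; apply/andP; split;
  apply: (le_lebesgue_off_null N0) => x [[]]; rewrite /= in_itv/= => x01 fy Nx;
  by split => //; move: fy => /=; rewrite (ff _ x01 Nx).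
Qed.

Lemma is_decr_rearr_off_null f0 f fs (N : set R) : mu N = 0%E ->
  (forall t, 0 < t < 1 -> ~ N t -> f0 t = f t) ->
  is_decr_rearr f0 fs <-> is_decr_rearr f fs.
Proof.
move=> N0 ff; have E := equidistributed_off_null N0 ff.
by split => -[d e]; split => // y; rewrite e E.
Qed.

(** A negative value at [t] would persist on []t, 1[], giving mass to a level where [f] has none; a
    value above 1 would persist on []0, t]], leaving level 1 less than full mass. *)
Lemma decr_rearr_range f fs t : (forall x, 0 <= f x <= 1) ->
  is_decr_rearr f fs -> 0 < t < 1 -> 0 <= fs t <= 1.
Proof.
move=> f01 [fsd fsE] t01; apply/andP; split; rewrite leNgt; apply/negP => ft.
- have := le_lebesgue_outer (A := `]t, 1[)
    (B := `]0, 1[ `&` [set x | fs x <= fs t]).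
  rewrite fsE (_ : [set x | f x <= fs t] = set0); last first.
    by apply/seteqP; split => x //=; have := f01 x; lra.
  rewrite setI0 measure0 lebesgue_oo; last lra.
  rewrite lee_fin => H; suff : 1 - t <= 0 by lra.
  apply: H => x; rewrite /= !in_itv/= => tx.
  by split; [lra|apply: fsd; lra].
- have := le_lebesgue_outer (B := `]t, 1[)
    (A := `]0, 1[ `&` [set x | fs x <= 1]).
  rewrite fsE (_ : [set x | f x <= 1] = setT); last first.
    by apply/seteqP; split => x //=; have := f01 x; lra.
  rewrite setIT !lebesgue_oo; [|lra..].
  rewrite lee_fin => H; suff : 1 - 0 <= 1 - t by lra.
  apply: H => x; rewrite /= !in_itv/= => -[x01 fx].
  apply/andP; split; last lra; rewrite ltNge; apply/negP => xt.
  by have := fsd x t; lra.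
Qed.

(** A rearrangement is unconstrained outside []0, 1[]. Setting it to 1 on the left and 0 on the
    right makes it nonincreasing on the line, hence Borel. *)
Lemma decr_rearr_unit f fs : unit_fun f -> is_decr_rearr f fs ->
  exists gs : R -> R, [/\ unit_fun gs, equidistributed f gs &
    forall t, 0 < t < 1 -> gs t = fs t].
Proof.
move=> [mf f01] fsP; have fs01 t := decr_rearr_range (t := t) f01 fsP.
case: (fsP) => fsd fsE.
pose gs t := if t <= 0 then 1 else if 1 <= t then 0 else fs t.
have gsE t : 0 < t < 1 -> gs t = fs t.
  by rewrite /gs; case: ifPn => [|_]; [lra|case: ifPn => //; lra].
have gs01 t : 0 <= gs t <= 1.
  rewrite /gs; case: ifPn => [|t0]; first lra.
  by case: ifPn => [|t1]; [lra|apply: fs01; lra].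
exists gs; split => //; last first.
  move=> y; rewrite -fsE; apply/eqP.
  by rewrite (equidistributed_off_null (measure0 _) (f0 := gs) (f := fs))// => t ? _; exact: gsE.
split => //; apply: nonincreasing_measurable => // s t st.
have gt := gs01 t; have gs' := gs01 s.
have [s0|s0] := leP s 0.
  rewrite (_ : gs s = 1); first lra.
  by rewrite /gs s0.
have [t1|t1] := leP 1 t.
  rewrite (_ : gs t = 0); first lra.
  by rewrite /gs t1 leNgt (lt_le_trans s0 st).
rewrite !gsE; [|lra..].
by have := fsd s t; lra.
Qed.

Lemma cum_int_eq f g v : (forall t, 0 < t < 1 -> f t = g t) -> v <= 1 ->
  cum_int f v = cum_int g v.
Proof.
move=> fg v1; have N0 : mu (set0 `|` [set 0; 1]) = 0%E.
  by apply: null_setU_endpoints; [exact: measurable0|exact: measure0].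
apply: (Rintegral_off_null _ N0).
  by apply: measurableU => //; apply: measurableU; exact: measurable_set1.
move=> x; rewrite /= in_itv/= => xv /not_orP[_ /not_orP[/eqP x0 /eqP x1]].
by apply: fg; move: x0 x1; rewrite !neq_lt; lra.
Qed.

Lemma cum_int_trunc1 f : (forall x, 0 <= f x <= 1) -> cum_int f 1 = trunc_int f 1.
Proof.
move=> f01; apply: eq_Rintegral => x _.
by apply/esym/min_idPl; have := f01 x => /andP[].
Qed.

Lemma decr_level fs c :
  (forall s t, 0 < s -> s <= t -> t < 1 -> fs t <= fs s) ->
  exists2 v, 0 <= v <= 1 & (forall t, 0 < t < v -> c <= fs t) /\
                           (forall t, v < t < 1 -> fs t <= c).
Proof.
(* The crossing point is the supremum of the strict superlevel set; 0 is adjoined in case that set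
   is empty. *)
move=> fsd; pose A := [set t | t = 0 \/ (0 < t < 1 /\ c < fs t)].
have A0 : A 0 by left.
have A1 x : A x -> x <= 1 by case => [->//|[]]; lra.
have hA : has_sup A by split; [exists 0|exists 1].
have sA x : A x -> x <= sup A by move=> ?; apply: ub_le_sup => //; exact: hA.2.
exists (sup A).
  by rewrite sA//=; apply: ge_sup => //; exact: hA.1.
split=> t tv.
- have [s As ts] : exists2 s, A s & t < s.
    have e0 : 0 < sup A - t by lra.
    by have [s As] := sup_adherent e0 hA; rewrite subKr => ts; exists s.
  case: As => [s0|[s01 cs]]; first by move: ts; rewrite s0; lra.
  by have := fsd t s; lra.
- rewrite leNgt; apply/negP => ct.
  have := sA t; rewrite /A/=.
  suff : 0 <= sup A by move=> ? H; have : t <= sup A by [apply: H; right; split => //; lra]; lra.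
  exact: sA.
Qed.

(* Conjugacy between the concave functions [cum_int fs] and [trunc_int f]:
   [cum_int fs v] is the minimum over [c] of [c * v + cum_int f 1 - trunc_int f c]. *)
Lemma decr_rearr_conjugate f fs : unit_fun f -> is_decr_rearr f fs ->
  [/\ forall v c, 0 <= v <= 1 -> 0 <= c ->
        cum_int fs v + trunc_int f c <= c * v + cum_int f 1,
      forall v, 0 < v < 1 -> exists2 c, 0 <= c <= 1 &
        cum_int fs v + trunc_int f c = c * v + cum_int f 1,
      forall c, 0 <= c -> exists2 v, 0 <= v <= 1 &
        cum_int fs v + trunc_int f c = c * v + cum_int f 1 &
      cum_int fs 1 = cum_int f 1].
Proof.
move=> uf fsP; have [gs [ugs fgs gsE]] := decr_rearr_unit uf fsP.
have cE v : v <= 1 -> cum_int fs v = cum_int gs v.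
  by move=> v1; apply: cum_int_eq => // t t01; rewrite gsE.
have tE c : 0 <= c -> trunc_int f c = trunc_int gs c.
  by move=> c0; exact: equidistributed_trunc.
have mE : cum_int f 1 = cum_int gs 1.
  by rewrite !cum_int_trunc1 ?tE//; [case: ugs|case: uf].
case: (fsP) => fsd _.
have mN : measurable (set0 : set (measurableTypeR R)) by exact: measurable0.
split.
- by move=> v c v01 c0; rewrite cE ?tE// ?mE; [exact: trunc_int_le|lra].
- move=> v v01; exists (gs v); first by case: ugs.
  have g0 : 0 <= gs v by case: ugs => _ /(_ v)/andP[].
  rewrite cE ?tE// ?mE; last lra.
  apply: (trunc_int_eq ugs g0 _ mN (measure0 _)); first lra.
    by move=> t tv _; rewrite !gsE; [apply: fsd; lra|lra..].
  by move=> t tv _; rewrite !gsE; [apply: fsd; lra|lra..].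
- move=> c c0; have [v v01 [lv rv]] := decr_level c fsd; exists v => //.
  rewrite cE ?tE// ?mE; last lra.
  apply: (trunc_int_eq ugs c0 v01 mN (measure0 _)).
    by move=> t tv _; rewrite gsE; [exact: lv|lra].
  by move=> t tv _; rewrite gsE; [exact: rv|lra].
- by rewrite cE// mE.
Qed.

(** * Existence of the decreasing rearrangement *)

Lemma ccdf_mfun_of f (mf : measurable_fun setT f) r :
  ccdf (mfun_of mf) r = mu (`]0, 1[ `&` [set t | r < f t]).
Proof.
transitivity (P (f @^-1` `]r, +oo[%classic)) => //.
rewrite uniform01E.
  by congr (mu (_ `&` _)); apply/seteqP; split => x /=; rewrite in_itv/= andbT.
by rewrite -[X in measurable X]setTI; exact: mf.
Qed.

(** The rearrangement is the generalized inverse of the survival function [G]. Existence is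
    essential because [schur_le] quantifies universally over rearrangements and would be vacuous
    without it. *)
Lemma decr_rearr_exists f : unit_fun f -> exists fs, is_decr_rearr f fs.
Proof.
move=> [mf f01]; pose G := ccdf (mfun_of mf).
pose S (s : R) := [set y : R | 0 <= y /\ (G y <= s%:E)%E].
have S1 s : 0 < s -> S s 1.
  move=> s0; split; rewrite ?ler01// /G ccdf_mfun_of.
  rewrite (_ : [set t | 1 < f t] = set0) ?setI0 ?measure0 ?lee_fin; first lra.
  by apply/seteqP; split => x //=; have := f01 x; lra.
have lbS s : lbound (S s) 0 by move=> y [].
have fs0 s : 0 < s -> 0 <= inf (S s).
  by move=> s0; apply: lb_le_inf; [exists 1; exact: S1|exact: lbS].
have fsP s y : 0 < s -> 0 <= y -> (inf (S s) <= y) = (G y <= s%:E)%E.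
  move=> s0 y0; apply/idP/idP => [Sy|Gy]; last first.
    by apply: ge_inf => //; exists 0.
  (* Every [z > y] satisfies [G z <= s]; right-continuity carries the bound down to [y]. *)
  have Gy : G z @[z --> y^'+] --> G y := @ccdf_right_continuous _ _ _ _ (mfun_of mf) y.
  apply: cvge_to_le Gy _.
  near=> z; have yz : y < z by near: z; exact: nbhs_right_gt.
  have [w [w0 Gw] wz] : exists2 w, S s w & w < z.
    apply: inf_lt; last exact: le_lt_trans Sy yz.
    by exists 1; exact: S1.
  by apply: le_trans Gw; apply: ccdf_nonincreasing; exact: ltW.
exists (fun s => inf (S s)); split.
  move=> s t s0 st t1; have t0 : 0 < t by lra.
  rewrite fsP ?fs0//; apply: (@le_trans _ _ s%:E); last by rewrite lee_fin.
  by rewrite -fsP ?fs0.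
move=> y; have [y0|y0] := ltP y 0.
  congr (mu _); apply/seteqP; split => s -[]; rewrite /= in_itv/= => s01.
    by have := fs0 s; lra.
  by have := f01 s; lra.
have GE := lebesgue_gtE y mf; rewrite -(ccdf_mfun_of mf) -/(G y) in GE.
have Lfin : mu (`]0, 1[ `&` [set t | f t <= y]) \is a fin_num.
  rewrite ge0_fin_numE; last exact: outer_measure_ge0.
  apply: (@le_lt_trans _ _ (mu `]0, 1[)); last by rewrite lebesgue_oo// ltry.
  by apply: le_lebesgue_outer => x [].
have Lge0 : (0 <= mu (`]0%R, 1%R[ `&` [set t | (f t <= y)%R]))%E.
  exact: outer_measure_ge0.
have Lle1 : (mu (`]0%R, 1%R[ `&` [set t | (f t <= y)%R]) <= 1)%E.
  apply: (@le_trans _ _ (mu `]0, 1[)); last by rewrite lebesgue_oo// subr0.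
  by apply: le_lebesgue_outer => x [].
move: GE Lge0 Lle1; rewrite -(fineK Lfin); set l := fine _ => GE.
rewrite !lee_fin => l0 l1.
have {}GE : G y = (1 - l)%:E by rewrite GE.
(* In []0, 1[] the sublevel set is given by [1 - l <= s]. It is squeezed between intervals with open
   and closed left end, since [1 - l] may be 0, which is outside []0, 1[]. *)
apply/eqP; rewrite eq_le; apply/andP; split.
- rewrite [leRHS](_ : _ = mu `[1 - l, 1[); last first.
    rewrite lebesgue_measure_itv/= lte_fin; case: ifPn => h.
      by rewrite -EFinD; congr (_%:E); lra.
    by congr (_%:E); lra.
  apply: le_lebesgue_outer => s [/=]; rewrite !in_itv/= => s01.
  by rewrite fsP ?GE ?lee_fin; lra.
- rewrite [leLHS](_ : _ = mu `]1 - l, 1[); last first.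
    by rewrite lebesgue_oo; [congr (_%:E); lra|lra].
  apply: le_lebesgue_outer => s; rewrite /= !in_itv/= => s01.
  by split; [lra|rewrite fsP ?GE ?lee_fin; lra].
Unshelve. all: by end_near. Qed.

End Rearrangement.

(** * The transformation T *)

Section Transform.
Context (R : realType).
Notation mu := (@lebesgue_measure R).
Implicit Types (f g fs F : R -> R) (c v u : R) (C D E : R -> R -> R).

(** By conjugacy [trunc_int f] lies below an affine function of slope [v] for each [v]; the [v]
    attaining equality at [c] is a supergradient there. *)
Lemma trunc_int_supergradient f c : unit_fun f -> 0 <= c ->
  exists2 v, 0 <= v <= 1 &
    forall c', 0 <= c' -> trunc_int f c' <= trunc_int f c + (c' - c) * v.
Proof.
move=> uf c0; have [fs fsP] := decr_rearr_exists uf.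
have [le_c _ eq_c _] := decr_rearr_conjugate uf fsP.
have [v v01 Ev] := eq_c c c0; exists v => // c' c'0.
have := le_c v c' v01 c'0; rewrite mulrBl; lra.
Qed.

(** Conjugation reverses the order. Given [c], use the [v] attaining equality for [f]; given [v],
    use the [c] attaining it for [g]. *)
Lemma schur_le_trunc f0 g0 f g (N M : set R) :
  unit_fun f -> unit_fun g -> mu N = 0%E -> mu M = 0%E ->
  (forall t, 0 < t < 1 -> ~ N t -> f0 t = f t) ->
  (forall t, 0 < t < 1 -> ~ M t -> g0 t = g t) ->
  cum_int f 1 = cum_int g 1 ->
  schur_le f0 g0 <-> forall c, 0 <= c <= 1 -> trunc_int g c <= trunc_int f c.
Proof.
move=> uf ug N0 M0 ff gg fg; split=> [fg0 c c01|H fs gs].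
  have [fs fsP] := decr_rearr_exists uf; have [gs gsP] := decr_rearr_exists ug.
  have [] := fg0 fs gs; [exact/(is_decr_rearr_off_null _ N0 ff)|
                         exact/(is_decr_rearr_off_null _ M0 gg)|].
  rewrite -/(cum_int fs 1) -/(cum_int gs 1) => fgs fgs1.
  have [_ _ eq_f f1] := decr_rearr_conjugate uf fsP.
  have [le_g _ _ _] := decr_rearr_conjugate ug gsP.
  have c0 : 0 <= c by case/andP: c01.
  have [v v01 Ev] := eq_f c c0; have := le_g v c v01 c0.
  suff : cum_int fs v <= cum_int gs v by rewrite -fg; lra.
  have [v0|v0] := eqVneq v 0; first by rewrite v0 /cum_int set_itv1 !Rintegral_set1.
  have [->|v1] := eqVneq v 1; first by rewrite fgs1.
  by apply: fgs; move: v0 v1; rewrite !neq_lt; lra.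
move=> /(is_decr_rearr_off_null _ N0 ff) fsP /(is_decr_rearr_off_null _ M0 gg) gsP.
have [le_f _ _ f1] := decr_rearr_conjugate uf fsP.
have [_ eq_g _ g1] := decr_rearr_conjugate ug gsP.
split; last by rewrite -/(cum_int fs 1) f1 fg -g1.
move=> v v01; rewrite -/(cum_int fs v) -/(cum_int gs v).
have [c c01 Ec] := eq_g v v01; have := H c c01.
have v01' : 0 <= v <= 1 by lra.
have c0 : 0 <= c by lra.
by have := le_f v c v01' c0; rewrite fg; lra.
Qed.

(** The one-variable consequences of the copula axioms that [T] preserves, so that every result on
    [T] applies again to [T C]. *)
Definition slices C := forall u, 0 <= u <= 1 ->
  [/\ C u 0 = 0, C u 1 = u & slope01 `[0, 1] (C u)].

Lemma copula_slices C : is_copula C -> slices C.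
Proof.
move=> [Cb C2] u u01; have [Cu0 [_ [Cu1 _]]] := Cb u u01; split => // s t.
rewrite /= !in_itv/= => s01 t01 st.
have [_ [C0s [_ C1s]]] := Cb s s01; have [_ [C0t [_ C1t]]] := Cb t t01.
(* The rectangle below [u] gives monotonicity in the second argument, the one above [u] the
   Lipschitz bound. *)
have h1 : 0 <= C u t - C u s - C 0 t + C 0 s by apply: C2; lra.
have h2 : 0 <= C 1 t - C 1 s - C u t + C u s by apply: C2; lra.
by move: h1 h2; rewrite C0s C0t C1s C1t; lra.
Qed.

Lemma slices_density C u : slices C -> 0 <= u <= 1 ->
  exists (f : R -> R) (N : set R), [/\ unit_fun f, measurable N /\ mu N = 0%E,
    forall t, 0 < t < 1 -> ~ N t -> derivable (C u) t 1 /\ d2 C u t = f t &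
    forall v, 0 <= v <= 1 -> cum_int f v = C u v].
Proof.
move=> CS u01; have [Cu0 _ CL] := CS u u01.
have [f [N [uf mN Nf fE]]] := slope01_density CL.
by exists f, N; split => // v v01; rewrite /cum_int fE// Cu0 subr0.
Qed.

Lemma d2_Pi v t : d2 (@Pi R) v t = v.
Proof.
have d : is_derive t 1 (v \*: (@idfun R)) (v *: 1) by exact: is_deriveZ.
by have := @derive_val _ _ _ _ _ _ _ d; rewrite -derive1E [v *: 1]mulr1.
Qed.

(** Since [d2 Pi v] is constantly [v], the join with [Pi] truncates the slice derivative at height
    [v]. *)
Lemma T_trunc C u f (N : set R) v : measurable N -> mu N = 0%E ->
  (forall t, 0 < t < 1 -> ~ N t -> d2 C u t = f t) ->
  T C u v = trunc_int f v.
Proof.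
move=> mN N0 ff; apply: (@Rintegral_off_null _ (N `|` [set 0; 1])).
- by apply: measurableU => //; apply: measurableU; exact: measurable_set1.
- exact: null_setU_endpoints.
- move=> x; rewrite /= in_itv/= => x01 /not_orP[Nx /not_orP[/eqP x0 /eqP x1]].
  by rewrite d2_Pi ff//; move: x0 x1; rewrite !neq_lt; lra.
Qed.

Lemma T_slices C : slices C -> slices (T C).
Proof.
move=> CS u u01; have [f [N [uf [mN N0] Nf fE]]] := slices_density CS u01.
have TE v : T C u v = trunc_int f v.
  by apply: (T_trunc v mN N0) => t t01 Nt; case: (Nf t t01 Nt).
have f01 x : 0 <= f x <= 1 by case: uf.
split.
- rewrite TE; transitivity (Rintegral mu `[0, 1] (fun=> 0)).
    by apply: eq_Rintegral => x _; apply/min_idPr; case/andP: (f01 x).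
  by rewrite Rintegral_cst0v// mul0r.
- by rewrite TE -cum_int_trunc1// fE ?ler01 ?lexx//; case: (CS u u01).
- move=> s t; rewrite /= !in_itv/= !TE => s01 t01 st.
  have s0 : 0 <= s by case/andP: s01.
  have t0 : 0 <= t by case/andP: t01.
  have [v v01 /(_ t t0) vs] := trunc_int_supergradient uf s0.
  have [w w01 /(_ s s0) ws] := trunc_int_supergradient uf t0.
  have : (t - s) * v <= t - s by rewrite ler_piMr//; lra.
  have : 0 <= (t - s) * w by rewrite mulr_ge0//; lra.
  have -> : (t - s) * w = - ((s - t) * w) by ring.
  by lra.
Qed.

(** Concavity in chord form: [c] separates the chord slopes left of [v] from those right of it. This
    is what [derive1_ge] and [derive1_le] consume. *)
Definition concave_slices C := forall u v, 0 <= u <= 1 -> 0 < v < 1 ->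
  exists2 c, 0 <= c &
    (forall s t, 0 <= s -> s <= t -> t <= v -> c * (t - s) <= C u t - C u s) /\
    (forall s t, v <= s -> s <= t -> t <= 1 -> C u t - C u s <= c * (t - s)).

Lemma T_concave C : slices C -> concave_slices (T C).
Proof.
move=> CS u v u01 v01; have [f [N [uf [mN N0] Nf fE]]] := slices_density CS u01.
have TE w : T C u w = trunc_int f w.
  by apply: (T_trunc w mN N0) => t t01 Nt; case: (Nf t t01 Nt).
have v0 : 0 <= v by lra.
have [c c01 cP] := trunc_int_supergradient uf v0.
exists c; first by case/andP: c01.
split => s t s0 st t0; rewrite !TE.
- have t0' : 0 <= t by lra.
  have [d d01 dP] := trunc_int_supergradient uf t0'.
  have := dP s s0; have := dP v v0; have := cP t t0'.
  have [->|tv] := eqVneq t v.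
    by move=> _ _ _; have := cP s s0; rewrite (_ : (s - v) * c = - (c * (v - s))); [lra|ring].
  have {}tv : 0 < v - t by move: tv; rewrite neq_lt; lra.
  move=> h1 h2 h3.
  (* Supergradients decrease: adding the inequality for [c] taken at [t] to that for [d] taken at
     [v] gives [c <= d], as [t < v]. *)
  have cd : c <= d.
    rewrite -(ler_pM2l tv).
    have : (t - v) * c = - ((v - t) * c) by ring.
    lra.
  have : c * (t - s) <= d * (t - s) by rewrite ler_wpM2r//; lra.
  have : (s - t) * d = - (d * (t - s)) by ring.
  lra.
- have s0' : 0 <= s by lra.
  have [d d01 dP] := trunc_int_supergradient uf s0'.
  have t0' : 0 <= t by lra.
  have := dP t t0'; have := dP v v0; have := cP s s0'.
  have [->|tv] := eqVneq s v.
    by move=> _ _ _; have := cP t t0'; rewrite (mulrC c); lra.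
  have {}tv : 0 < s - v by move: tv; rewrite neq_lt; lra.
  move=> h1 h2 h3.
  have cd : d <= c.
    rewrite -(ler_pM2l tv).
    have : (v - s) * d = - ((s - v) * d) by ring.
    lra.
  have : d * (t - s) <= c * (t - s) by rewrite ler_wpM2r//; lra.
  have : (t - s) * d = d * (t - s) by ring.
  lra.
Qed.

(* A slice with decreasing derivative is its own rearrangement. *)
Lemma concave_rearr C u fs : slices C -> concave_slices C -> 0 <= u <= 1 ->
  is_decr_rearr (d2 C u) fs -> forall v, 0 < v < 1 \/ v = 1 -> cum_int fs v = C u v.
Proof.
move=> CS CC u01 fsP; have [f [N [uf [mN N0] Nf fE]]] := slices_density CS u01.
have ff t : 0 < t < 1 -> ~ N t -> d2 C u t = f t.
  by move=> t01 Nt; case: (Nf t t01 Nt).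
move: fsP => /(is_decr_rearr_off_null _ N0 ff) fsP.
have [le_f ex_f _ f1] := decr_rearr_conjugate uf fsP.
move=> v [v01|->]; last by rewrite f1 fE// ler01 lexx.
have v01' : 0 <= v <= 1 by lra.
have [c c0 [lc rc]] := CC u v u01 v01.
rewrite -fE//.
(* The separating slope [c] puts [f] itself in the equality case at [v], so conjugacy at [c] gives
   [cum_int fs v <= cum_int f v]. The reverse comes from the [c'] attaining equality for [fs]. *)
have fc : cum_int f v + trunc_int f c = c * v + cum_int f 1.
  apply: (trunc_int_eq uf c0 v01' mN N0) => t tv Nt.
    have [|dt dE] := Nf t _ Nt; first lra.
    rewrite -dE; apply: (derive1_ge tv) => // s r s0 sr rv; apply: lc; lra.
  have [|dt dE] := Nf t _ Nt; first lra.
  rewrite -dE; apply: (derive1_le tv) => // s r s0 sr rv; apply: rc; lra.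
have := le_f v c v01' c0.
have [c' c'01 fc'] := ex_f v v01.
have c'0 : 0 <= c' by lra.
have := trunc_int_le uf c'0 v01'; rewrite -/(cum_int f v) -/(cum_int f 1).
lra.
Qed.

(** * Comparison of the orders *)

Lemma slices_endpoints C v : slices C -> 0 <= v <= 1 -> C 0 v = 0 /\ C 1 v = v.
Proof.
move=> CS v01.
have z01 : 0 <= (0 : R) <= 1 by rewrite lexx ler01.
have o01 : 0 <= (1 : R) <= 1 by rewrite lexx ler01.
have [C00 C01 C0L] := CS 0 z01; have [C10 C11 C1L] := CS 1 o01.
have i0 : `[0, 1]%classic (0 : R) by rewrite /= in_itv/= lexx ler01.
have i1 : `[0, 1]%classic (1 : R) by rewrite /= in_itv/= lexx ler01.
have iv : `[0, 1]%classic v by rewrite /= in_itv.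
have h1 := C0L _ _ i0 iv; have h2 := C0L _ _ iv i1.
have h3 := C1L _ _ i0 iv; have h4 := C1L _ _ iv i1.
(* The slice at 0 is monotone from 0 to 0; the slice at 1 rises by 1 over a unit length with slope
   at most 1. *)
split; lra.
Qed.

(** Bridges the ranges of the two orders: [le_d2S] concerns interior slices only, and the boundary
    slices of [D] and [E] coincide. *)
Lemma le_loP D E : slices D -> slices E ->
  (forall u, 0 < u < 1 -> forall v, 0 <= v <= 1 -> D u v <= E u v) -> le_lo D E.
Proof.
move=> DS ES H u v u01 v01.
have [D0 D1] := slices_endpoints DS v01; have [E0 E1] := slices_endpoints ES v01.
have [->|u0] := eqVneq u 0; first by rewrite D0 E0.
have [->|u1] := eqVneq u 1; first by rewrite D1 E1.
by apply: H => //; move: u0 u1; rewrite !neq_lt; lra.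
Qed.

Lemma le_d2S_T D E : slices D -> slices E -> le_d2S D E <-> le_lo (T E) (T D).
Proof.
move=> DS ES.
have H u : 0 < u < 1 -> schur_le (d2 D u) (d2 E u) <->
    forall v, 0 <= v <= 1 -> T E u v <= T D u v.
  move=> u01; have u01' : 0 <= u <= 1 by lra.
  have [f [N [uf [mN N0] Nf fE]]] := slices_density DS u01'.
  have [g [M [ug [mM M0] Mg gE]]] := slices_density ES u01'.
  have ff t : 0 < t < 1 -> ~ N t -> d2 D u t = f t.
    by move=> t01 Nt; case: (Nf t t01 Nt).
  have gg t : 0 < t < 1 -> ~ M t -> d2 E u t = g t.
    by move=> t01 Nt; case: (Mg t t01 Nt).
  (* Both slices rise from 0 to [u], so the densities have the same mean, as the Schur order
     requires. *)
  have fg1 : cum_int f 1 = cum_int g 1.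
    have [_ D1 _] := DS u u01'; have [_ E1 _] := ES u u01'.
    by rewrite fE ?gE ?ler01 ?lexx// D1 E1.
  split.
    move=> /(schur_le_trunc uf ug N0 M0 ff gg fg1) K v v01.
    by rewrite (T_trunc v mN N0 ff) (T_trunc v mM M0 gg); exact: K.
  move=> K; apply/(schur_le_trunc uf ug N0 M0 ff gg fg1) => v v01.
  by rewrite -(T_trunc v mN N0 ff) -(T_trunc v mM M0 gg); exact: K.
split.
  move=> DE; apply: le_loP; [exact: T_slices|exact: T_slices|].
  by move=> u u01; apply/H => //; exact: DE.
move=> TED u u01; apply/(H u u01) => v v01; apply: TED; [lra|exact: v01].
Qed.

(** By [concave_rearr] the rearranged integrals are the values [C u v] themselves, so both orders
    compare the same numbers. *)
Lemma le_d2S_concave D E : slices D -> slices E -> concave_slices D ->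
  concave_slices E -> le_d2S D E <-> le_lo D E.
Proof.
move=> DS ES DC EC; split=> [DE|DE u u01 fs gs fsP gsP]; last first.
  have u01' : 0 <= u <= 1 by lra.
  have [_ D1 _] := DS u u01'; have [_ E1 _] := ES u u01'.
  have fE := concave_rearr DS DC u01' fsP; have gE := concave_rearr ES EC u01' gsP.
  split; last by rewrite -/(cum_int fs 1) -/(cum_int gs 1) fE ?gE ?D1 ?E1//; right.
  move=> v v01; rewrite -/(cum_int fs v) -/(cum_int gs v) fE ?gE; [|by left|by left].
  by apply: DE => //; lra.
apply: le_loP => // u u01 v v01; have u01' : 0 <= u <= 1 by lra.
have [D0 D1 _] := DS u u01'; have [E0 E1 _] := ES u u01'.
have [->|v0] := eqVneq v 0; first by rewrite D0 E0.
have [->|v1] := eqVneq v 1; first by rewrite D1 E1.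
have {v0 v1 v01} v01 : 0 < v < 1 by move: v0 v1; rewrite !neq_lt; lra.
have ex C : slices C -> exists fs, is_decr_rearr (d2 C u) fs.
  move=> CS; have [f [N [uf [mN N0] Nf fE]]] := slices_density CS u01'.
  have [fs fsP] := decr_rearr_exists uf; exists fs.
  have ff t : 0 < t < 1 -> ~ N t -> d2 C u t = f t.
    by move=> t01 Nt; case: (Nf t t01 Nt).
  exact/(is_decr_rearr_off_null fs N0 ff).
have [fs fsP] := ex D DS; have [gs gsP] := ex E ES.
have [/(_ v v01) + _] := DE u u01 fs gs fsP gsP.
rewrite -/(cum_int fs v) -/(cum_int gs v).
rewrite (concave_rearr DS DC u01' fsP); last by left.
by rewrite (concave_rearr ES EC u01' gsP)//; left.
Qed.

End Transform.

Theorem mainTheorem16 (R : realType) (D E : R -> R -> R) :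
  is_copula D -> is_copula E ->
  [/\ (le_d2S D E <-> le_lo (T E) (T D)),
      (le_d2S D E <-> le_d2S (T E) (T D)),
      (le_d2S D E <-> le_lo (T2 D) (T2 E)) &
      (le_d2S D E <-> le_d2S (T2 D) (T2 E))].
Proof.
move=> /copula_slices DS /copula_slices ES.
have TDS := T_slices DS; have TES := T_slices ES.
have i_ii := le_d2S_T DS ES.
have iii_ii := le_d2S_concave TES TDS (T_concave ES) (T_concave DS).
(* The type annotation folds [T (T D)] into [T2 D]; the second order reversal restores the original
   direction. *)
have iii_iv : le_d2S (T E) (T D) <-> le_lo (T2 D) (T2 E) := le_d2S_T TES TDS.
have v_iv : le_d2S (T2 D) (T2 E) <-> le_lo (T2 D) (T2 E) :=
  le_d2S_concave (T_slices TDS) (T_slices TES) (T_concave TDS) (T_concave TES).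
have i_iii := iff_trans i_ii (iff_sym iii_ii).
have i_iv := iff_trans i_iii iii_iv.
split; [exact: i_ii|exact: i_iii|exact: i_iv|exact: iff_trans i_iv (iff_sym v_iv)].
Qed.
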